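(* Let $a,b\in\mathbb{R}$ satisfy $\tfrac12\le a<\tfrac58$ and $0<b<\tfrac12$, and let $c_{W,1},c_{W,2},c_w>0$. Let $\mu=(\mu_k)_{k\in\mathbb{N}^*}$ be an increasing sequence of distinct real numbers with $\mu_1\ge 1$ such that $$c_{W,1}\Gamma^{a}-c_{W,2}\Gamma^{b}\le \mathcal N_\mu(\Gamma)\le c_{W,1}\Gamma^{a}+c_{W,2}\Gamma^{b}\qquad\text{for all }\Gamma\ge\mu_1,$$ $$\mu_{k+1}-\mu_k\ge \exp\left(-c_w\mu_k^{1/2}\right)\qquad\text{for all }k\in\mathbb{N}^*.$$ Let $z=(z_k)_{k\in\mathbb{N}^*}\in\ell^2$ be a real sequence for which there exist $C_z>0$ and $\delta\in(0,1)$ such that $|z_k|\ge\exp(-C_z\mu_k^{1-\delta})$ for all $k\in\mathbb{N}^*$. Set $\varepsilon=\tfrac14\min(5-8a,\,1-2b)$ and $\alpha_{\varepsilon,\delta}=\max\left(\tfrac{1-\varepsilon}{\varepsilon},\tfrac{1-\delta}{\delta}\right)$. Then there exists a constant $C=C(a,b,\varepsilon,\delta,z,\mu,c_{W,1},c_{W,2},c_w)>0$ such that for any $T\in(0,1)$ and any $x=(x_k)_{k\in\mathbb{N}^*}\subset\mathbb{R}$ with $zx:=(z_kx_k)_{k\in\mathbb{N}^*}\in\ell^2$, there exists $u\in L^2(0,T)$ such that $$x_k=\int_0^T e^{t\mu_k}u(t)\,dt\qquad\text{for all }k\in\mathbb{N}^*,$$ and $$\|u\|_{L^2(0,T)}\le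 C\exp\left(\frac{C}{T^{\alpha_{\varepsilon,\delta}}}\right)\|zx\|_{\ell^2}.$$
   Context: $\mathbb{N}^*=\{1,2,3,\dots\}$. For a non-decreasing sequence $\lambda=(\lambda_k)_{k\in\mathbb{N}^*}$ of positive reals, its counting function is $\mathcal N_\lambda(\Gamma)=\#\{k\in\mathbb{N}^*:\lambda_k\le\Gamma\}$. All function and sequence spaces are real: $L^2(0,T)=L^2(0,T;\mathbb{R})$, $\ell^2=\ell^2(\mathbb{N}^*;\mathbb{R})$. *)

(* Defs.v *)
From HB Require Import structures.
From mathcomp Require Import all_boot all_order all_algebra.
From mathcomp Require Import all_classical all_reals all_analysis.

Set Implicit Arguments.
Unset Strict Implicit.
Unset Printing Implicit Defensive.

Import Order.TTheory GRing.Theory Num.Theory.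
Import numFieldNormedType.Exports.

Local Open Scope classical_set_scope.
Local Open Scope ring_scope.

(* Sequences indexed by N* = {1, 2, 3, ...} are functions on nat: the k-th term
   of the mathematical sequence is the value at k.-1 (so mu_1 is [mu 0%N]). *)

(* Extended-real valued: +oo when infinitely many terms are <= Gamma. *)
Definition counting_function (R : realType) (lambda : nat -> R) (Gamma : R)
    : \bar R :=
  counting [set k | lambda k <= Gamma].

Definition l2_norm (R : realType) (x : nat -> R) : \bar R :=
  Lnorm counting 2%:E (EFin \o x).

Definition in_l2 (R : realType) (x : nat -> R) : Prop :=
  x \in Lfun counting 2%:E.

Definition lebesgue_0T (R : realType) (T : R)
    : {measure set (measurableTypeR R) -> \bar R} :=
  mrestr lebesgue_measure (measurable_itv `]0, T[).

Definition L2_norm (R : realType) (T : R) (u : R -> R) : \bar R :=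
  Lnorm (lebesgue_0T T) 2%:E (EFin \o u).

(* Elements of L^2(0,T) are represented by functions measurable on the whole
   line; only their values on ]0, T[ matter, and every class has such a
   representative (extend by 0). *)
Definition in_L2 (R : realType) (T : R) (u : R -> R) : Prop :=
  (u : measurableTypeR R -> R) \in Lfun (lebesgue_0T T) 2%:E.

Definition epsilon (R : realType) (a b : R) : R :=
  4^-1 * Num.min (5 - 8 * a) (1 - 2 * b).

Definition alpha (R : realType) (eps delta : R) : R :=
  Num.max ((1 - eps) / eps) ((1 - delta) / delta).

(* Main.v *)
(* The moment problem is solved by an explicit biorthogonal family.  Convolving a
   window supported in ]T/4, T/2[ with delta_0 - exp(- mu_j tau_j) delta_{tau_j}
   multiplies its moment against exp(t s) by 1 - exp((s - mu_j) tau_j), which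
   vanishes exactly at s = mu_j.  With tau_j proportional to T mu_j^(-3/4), a
   summable sequence as a < 5/8 < 3/4, the convolution over all j <> k stays in
   ]0, T[ and is bounded by exp(C / T^3).  At s = mu_k its moment is at least
   (T / 4) exp(T mu_k / 4) times the product of the |1 - exp((mu_k - mu_j) tau_j)|.
   The factors with mu_j > 2 mu_k cost exp(C / T^3); there are O(mu_k^a) others,
   each costing a power of mu_k / T, and only O(mu_k^b) of them lie within
   distance 1 of mu_k, where the gap condition costs exp(C mu_k^(1/2)).  The total
   loss, as well as the lower bound on |z_k|, is absorbed by exp(T mu_k / 4) up to
   exp(C / T^alpha), and sum_k x_k v_k / <v_k, exp(t mu_k)> is the control. *)
Require Import Defs.
From HB Require Import structures.
From mathcomp Require Import all_boot all_order all_algebra.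
From mathcomp Require Import all_classical all_reals all_analysis measurable_realfun.
From mathcomp Require Import zify ring lra.

Set Implicit Arguments.
Unset Strict Implicit.
Unset Printing Implicit Defensive.

Import Order.TTheory GRing.Theory Num.Theory.
Import numFieldNormedType.Exports.

Local Open Scope classical_set_scope.
Local Open Scope ring_scope.

(** * Exponential moments of bounded functions supported in ]0, T[, and their limits *)

Definition moment (R : realType) (f : R -> R) (s : R) : R :=
  \int[lebesgue_measure]_t (expR (t * s) * f t).

(** A sup bound valid at every point, rather than an L2 norm, because it is stable under
    translations and pointwise limits and provides the majorant for dominated convergence. *)
Definition bounded_on (R : realType) (T : R) (f : R -> R) (M : R) : Prop :=
  [/\ measurable_fun [set: R] f,
      (forall t, ~~ (0 < t < T) -> f t = 0)
    & forall t, `|f t| <= M].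

Section Moments.
Context (R : realType).
Implicit Types (f g : R -> R) (s T M : R).

Lemma integrable_moment T f M s : bounded_on T f M ->
  lebesgue_measure.-integrable [set: R] (EFin \o (fun t => expR (t * s) * f t)).
Proof.
move=> [mf f0 fM].
have M0 : 0 <= M by exact: le_trans (fM 0).
have mh : measurable_fun [set: R] (fun t => expR (t * s) * f t).
  apply: measurable_funM => //.
  apply: measurableT_comp => //; exact: measurable_funM.
have -> : EFin \o (fun t => expR (t * s) * f t) =
    (EFin \o (fun t => expR (t * s) * f t)) \_ `]0, T[.
  apply/funext => t; rewrite patchE; case: ifPn => //.
  by rewrite notin_setE /= in_itv /= => /negP/f0 ->; rewrite mulr0.
apply: (iffLR (@integrable_mkcond _ _ _ lebesgue_measure `]0, T[ _ _)) => //.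
apply: (@measurable_bounded_integrable _ _ R lebesgue_measure _ `]0, T[) => //.
- by rewrite [X in (X < _)%E]lebesgue_measure_itv /=; case: ifP => // _; rewrite -EFinB ltry.
- exact: (measurable_funTS mh).
- exists (expR (T * `|s|) * M); split; first exact: num_real.
  move=> x xM t /=; rewrite in_itv /= => /andP[t0 tT].
  apply: le_trans (ltW xM); rewrite normrM ger0_norm ?expR_ge0//.
  apply: ler_pM; rewrite ?expR_ge0// ler_expR.
  by apply: le_trans (ler_norm _) _; rewrite normrM gtr0_norm// ler_wpM2r// ltW.
Qed.

Lemma momentB T f g M N s : bounded_on T f M -> bounded_on T g N ->
  moment (fun t => f t - g t) s = moment f s - moment g s.
Proof.
move=> bf bg; rewrite /moment -(RintegralB _ (integrable_moment s bf) (integrable_moment s bg))//.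
by apply: eq_Rintegral => t _; rewrite mulrBr.
Qed.

Lemma momentZ T f M c s : bounded_on T f M ->
  moment (fun t => c * f t) s = c * moment f s.
Proof.
move=> bf; rewrite /moment -(RintegralZl c _ (integrable_moment s bf))//.
by apply: eq_Rintegral => t _; rewrite mulrCA.
Qed.

(** Lebesgue measure is determined by its values on half-open intervals, hence equals its
    pushforward under a translation. *)
Lemma integral_shift (h : R -> R) c :
  measurable_fun [set: R] h ->
  lebesgue_measure.-integrable [set: R] (EFin \o (fun t => h (t - c))) ->
  \int[lebesgue_measure]_t h (t - c) = \int[lebesgue_measure]_t h t.
Proof.
move=> mh ih.
have mphi : measurable_fun [set: measurableTypeR R]
    ((fun t => t - c) : measurableTypeR R -> measurableTypeR R).
  exact: measurable_funB.
have inv (A : set (measurableTypeR R)) : measurable A -> lebesgue_measure A =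
    pushforward lebesgue_measure
      ((fun t => t - c) : measurableTypeR R -> measurableTypeR R) A.
  move=> mA; apply: lebesgue_measure_unique => //= _ [[a b]] _ <-.
  rewrite /pushforward.
  have -> : (fun t : R => t - c) @^-1` `]a, b] = `]a + c, b + c]%classic.
    by apply/seteqP; split => x /=; rewrite !in_itv /= ltrBrDr lerBlDr.
  rewrite !lebesgue_measure_itv /= !lte_fin ltrD2r.
  by case: ifP => // _; rewrite -!EFinB; congr EFin; ring.
rewrite /Rintegral; congr fine.
rewrite -[LHS](@integral_pushforward _ _ (measurableTypeR R) (measurableTypeR R) R
   _ mphi lebesgue_measure setT (EFin \o h)) //; last exact/measurable_EFinP.
by apply: eq_measure_integral => A mA _; apply: esym; apply: inv.
Qed.

Lemma bounded_on_shift T f M c : 0 <= c -> bounded_on T f M ->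
  bounded_on (T + c) (fun t => f (t - c)) M.
Proof.
move=> c0 [mf f0 fM]; split.
- by apply: (measurableT_comp mf); exact: measurable_funB.
- move=> t ht; apply: f0; apply: contra ht => /andP[h1 h2].
  by apply/andP; split; lra.
- by move=> t; exact: fM.
Qed.

Lemma moment_shift T f M c s : 0 <= c -> bounded_on T f M ->
  moment (fun t => f (t - c)) s = expR (c * s) * moment f s.
Proof.
move=> c0 bf; rewrite -(momentZ _ _ bf) /moment.
rewrite -(@integral_shift (fun t => expR (t * s) * (expR (c * s) * f t)) c).
- apply: eq_Rintegral => t _; rewrite [RHS]mulrA -expRD; congr (expR _ * _).
  by ring.
- case: bf => mf _ _; apply: measurable_funM; last exact: measurable_funM.
  by apply: measurableT_comp => //; exact: measurable_funM.
- have := integrable_moment s (bounded_on_shift c0 bf).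
  congr (integrable _ _ _); apply/funext => t /=; congr EFin.
  by rewrite [RHS]mulrA -expRD; congr (expR _ * _); ring.
Qed.

Lemma bounded_on_le T T' f M M' : T <= T' -> M <= M' ->
  bounded_on T f M -> bounded_on T' f M'.
Proof.
move=> TT MM [mf f0 fM]; split => // [t ht|t]; last exact: le_trans (fM t) MM.
apply: f0; apply: contra ht => /andP[-> /lt_le_trans]; exact.
Qed.

Lemma bounded_onZ T f M c : bounded_on T f M ->
  bounded_on T (fun t => c * f t) (`|c| * M).
Proof.
move=> [mf f0 fM]; split; first exact: measurable_funM.
- by move=> t ht; rewrite f0// mulr0.
- by move=> t; rewrite normrM ler_wpM2l.
Qed.

Lemma bounded_onB T f g M N : bounded_on T f M -> bounded_on T g N ->
  bounded_on T (fun t => f t - g t) (M + N).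
Proof.
move=> [mf f0 fM] [mg g0 gN]; split; first exact: measurable_funB.
- by move=> t ht; rewrite f0// g0// subrr.
- by move=> t; apply: le_trans (ler_normB _ _) _; apply: lerD.
Qed.

(** Dominated convergence, the majorant being the exponential weight times M on ]0, T[. *)
Lemma moment_cvg T (f : nat -> R -> R) g M s :
  (forall n, bounded_on T (f n) M) ->
  (forall t, f n t @[n --> \oo] --> g t) ->
  bounded_on T g M /\ moment (f n) s @[n --> \oo] --> moment g s.
Proof.
move=> bf fg.
have bg : bounded_on T g M.
  split.
  - apply: (@measurable_fun_cvg _ _ _ _ f) => [n|t _]; last exact: fg.
    by case: (bf n).
  - move=> t ht; rewrite -(cvg_lim _ (fg t))//.
    rewrite (_ : (fun n => f n t) = cst 0) ?lim_cst//.
    by apply/funext => n; case: (bf n) => _ /(_ t ht).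
  - move=> t; rewrite -(cvg_lim _ (cvg_norm (fg t)))//.
    apply: limr_le; first exact: (cvgP _ (cvg_norm (fg t))).
    by near=> n; case: (bf n) => _ _; exact.
split => //.
pose D : R -> R := fun t => expR (t * s) * (M * \1_(`]0, T[%classic) t).
have bD : bounded_on T (fun t => M * \1_(`]0, T[%classic) t) `|M|.
  split.
  - by apply: measurable_funM => //; exact: measurable_indic.
  - by move=> t ht; rewrite indicE memNset ?mulr0//= in_itv /=; exact/negP.
  - move=> t; rewrite normrM indicE; case: (_ \in _); last by rewrite normr0 mulr0.
    by rewrite normr1 mulr1.
apply: fine_cvg; rewrite fineK; last first.
  by apply: integrable_fin_num => //; exact: integrable_moment bg.
have [] // := @dominated_convergence _ _ R lebesgue_measure setT measurableT
  (fun n => EFin \o (fun t => expR (t * s) * f n t))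
  (EFin \o (fun t => expR (t * s) * g t)) (EFin \o D).
- by move=> n; apply: (measurable_int lebesgue_measure); exact: integrable_moment (bf n).
- by apply: (measurable_int lebesgue_measure); exact: integrable_moment bg.
- apply: aeW => t _; apply: cvg_EFin; first by near=> n.
  by apply: cvgMr; exact: fg.
- exact: integrable_moment bD.
- apply: aeW => t n _ /=; rewrite lee_fin /D normrM ger0_norm ?expR_ge0//.
  rewrite ler_wpM2l ?expR_ge0// indicE.
  have [tT|tT] := boolP (0 < t < T).
    rewrite mem_set /=; last by rewrite in_itv.
    by rewrite mulr1; case: (bf n).
  rewrite memNset /=; last by rewrite in_itv /=; exact/negP.
  by case: (bf n) => _ /(_ t tT) -> _; rewrite normr0 mulr0.
Unshelve. all: by end_near. Qed.

End Moments.

Lemma bounded_increments_cvg (R : realType) (u : nat -> R) (M : R) :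
  (forall n, \sum_(k < n) `|u k.+1 - u k| <= M) -> cvgn u.
Proof.
move=> uM.
have -> : u = (fun n => u 0%N + series (telescope u) n).
  by apply/funext => n; exact: eq_sum_telescope.
apply: is_cvgD; first exact: is_cvg_cst.
apply: normed_cvg; apply: nondecreasing_is_cvgn.
  by apply: nondecreasing_series => n _ _; exact: normr_ge0.
by exists M => _ [n _ <-] /=; rewrite /series /= big_mkord; exact: uM.
Qed.

(** * Infinite convolutions whose moments vanish at prescribed nodes *)

Section AnnihilatingFunction.
Context (R : realType).

(** Starting at T/4 yields the gain exp(T s / 4) that pays for all later losses; ending at T/2
    leaves length T/2 for the shifts. *)
Definition window (T t : R) : R := \1_(`]T / 4, T / 2[%classic) t.

(** The convolution of f with the measures delta_0 - b_m delta_{tau_m}, m < n. A zero weight makes a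
    factor trivial. *)
Fixpoint shifted_differences (f : R -> R) (b tau : nat -> R) (n : nat) (t : R) :=
  if n is m.+1 then
    shifted_differences f b tau m t -
      b m * shifted_differences f b tau m (t - tau m)
  else f t.

Lemma bounded_on_window (T : R) : 0 < T -> bounded_on (T / 2) (window T) 1.
Proof.
move=> T0; split.
- exact: measurable_indic.
- move=> t ht; rewrite /window indicE memNset//= in_itv /=.
  by apply: contraNnot ht => /andP[? ?]; apply/andP; split; lra.
- by move=> t; rewrite /window indicE; case: (_ \in _); rewrite ?normr1 ?normr0.
Qed.

Lemma moment_window_ge (T s : R) : 0 < T -> 0 <= s ->
  T / 4 * expR (T / 4 * s) <= moment (window T) s.
Proof.
move=> T0 s0; have bw := bounded_on_window T0.
have -> : T / 4 * expR (T / 4 * s) = expR (T / 4 * s) * moment (window T) 0.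
  rewrite mulrC; congr (_ * _); rewrite /moment.
  under eq_Rintegral do rewrite mulr0 expR0 mul1r.
  rewrite /Rintegral (_ : (fun _ => _) = (fun t => (\1_(`]T / 4, T / 2[%classic) t)%:E))//.
  rewrite integral_indic// setIT [X in fine X]lebesgue_measure_itv /= lte_fin.
  by rewrite ifT; [rewrite -EFinB /=; field | lra].
rewrite -(momentZ _ _ bw) /moment; apply: le_Rintegral => //.
- exact: integrable_moment (bounded_onZ _ bw).
- exact: integrable_moment bw.
- move=> t _; rewrite mulr0 expR0 mul1r /window indicE.
  have [|] := boolP (t \in _); last by rewrite !mulr0.
  rewrite inE /= in_itv /= !mulr1 => /andP[ht _].
  by rewrite ler_expR ler_wpM2r// ltW.
Qed.

(** Each factor lengthens the support by tau_m and multiplies the sup bound by 1 + b_m <=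
    exp(b_m). *)
Lemma bounded_on_shifted_differences (f : R -> R) (b tau : nat -> R) (T M : R) n :
  (forall j, 0 <= b j) -> (forall j, 0 <= tau j) -> bounded_on T f M ->
  bounded_on (T + \sum_(j < n) tau j) (shifted_differences f b tau n)
    (M * expR (\sum_(j < n) b j)).
Proof.
move=> b0 tau0 bf; elim: n => [|n IH].
  by rewrite !big_ord0 addr0 expR0 mulr1.
have M0 : 0 <= M by case: bf => _ _ /(_ 0); exact: le_trans.
rewrite !big_ord_recr /= expRD addrA.
have IHw := bounded_on_le (ler_wpDr (tau0 n) (lexx _)) (lexx _) IH.
have := bounded_onB IHw (bounded_onZ (b n) (bounded_on_shift (tau0 n) IH)).
apply: bounded_on_le => //.
rewrite ger0_norm// -{1}[X in X + _]mul1r -mulrDl.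
rewrite [leRHS]mulrA [leRHS]mulrC ler_wpM2r ?expR_ge1Dx//.
by rewrite mulr_ge0// expR_ge0.
Qed.

Lemma moment_shifted_differences (f : R -> R) (b tau : nat -> R) (T M s : R) n :
  (forall j, 0 <= b j) -> (forall j, 0 <= tau j) -> bounded_on T f M ->
  moment (shifted_differences f b tau n) s =
  (\prod_(j < n) (1 - b j * expR (tau j * s))) * moment f s.
Proof.
move=> b0 tau0 bf; elim: n => [|n IH]; first by rewrite big_ord0 mul1r.
have bn := bounded_on_shifted_differences n b0 tau0 bf.
have bs := bounded_on_shift (tau0 n) bn.
have bn' := bounded_on_le (ler_wpDr (tau0 n) (lexx _)) (lexx _) bn.
have bz := bounded_onZ (b n) bs.
rewrite [LHS](momentB s bn' bz) (momentZ _ _ bs) (moment_shift _ (tau0 n) bn).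
by rewrite IH big_ord_recr /=; ring.
Qed.

(** The convolution products converge pointwise and stay bounded, so their moments converge to those
    of the limit. Bounding all partial products from below by one constant exp(-c) carries the lower
    bound over to the limit. *)
Lemma annihilating_function (P : pred nat) (nu tau : nat -> R) (T B : R) :
  0 < T -> (forall j, 0 <= tau j) ->
  (forall n, \sum_(j < n) tau j <= T / 2) ->
  (forall n, \sum_(j < n) expR (- (nu j * tau j)) <= B) ->
  exists v : R -> R,
    [/\ bounded_on T v (expR B),
        forall j, P j -> moment v (nu j) = 0
      & forall s c, 0 <= s ->
          (forall n, expR (- c) <=
             \prod_(j < n | P j) `|1 - expR ((s - nu j) * tau j)|) ->
          T / 4 * expR (T / 4 * s - c) <= `|moment v s|].
Proof.
move=> T0 tau0 tauT nuB.
pose b j : R := if P j then expR (- (nu j * tau j)) else 0.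
have b0 j : 0 <= b j by rewrite /b; case: ifP; rewrite ?expR_ge0.
have bB n : \sum_(j < n) b j <= B.
  apply: le_trans (nuB n); apply: ler_sum => j _.
  by rewrite /b; case: ifP; rewrite ?expR_ge0.
pose U := shifted_differences (window T) b tau.
have bU n : bounded_on T (U n) (expR B).
  have := bounded_on_shifted_differences n b0 tau0 (bounded_on_window T0).
  apply: bounded_on_le; first by have := tauT n; lra.
  by rewrite mul1r ler_expR.
have mU n s : moment (U n) s =
    (\prod_(j < n | P j) (1 - expR ((s - nu j) * tau j))) * moment (window T) s.
  rewrite (moment_shifted_differences _ _ b0 tau0 (bounded_on_window T0)).
  congr (_ * _); rewrite [RHS]big_mkcond; apply: eq_bigr => j _.
  rewrite /b; case: ifP => _; last by rewrite mul0r subr0.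
  by rewrite -expRD; congr (1 - expR _); ring.
(* The j-th increment is [b j] times a translate of [U j], hence at most [b j] exp(B), which is
   summable. *)
have cU t : cvgn (fun n => U n t).
  apply: (@bounded_increments_cvg _ _ (B * expR B)) => n.
  apply: le_trans (ler_wpM2r (expR_ge0 _) (bB n)).
  rewrite mulr_suml; apply: ler_sum => j _.
  rewrite /U /= addrC addKr normrN normrM ger0_norm// ler_wpM2l//.
  by case: (bU j) => _ _; exact.
pose v t := limn (fun n => U n t).
have mv s := moment_cvg s bU (cU : forall t, U n t @[n --> \oo] --> v t).
exists v; split; first by case: (mv 0).
- move=> j Pj; have [_ mvj] := mv (nu j).
  rewrite -(cvg_lim _ mvj)//; apply: lim_near_cst => //.
  (* As soon as n > j the product contains the zero factor of j, so the sequence of moments is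
     eventually 0. *)
  near=> n; rewrite mU.
  have jn : (j < n)%N by near: n; exists j.+1.
  by rewrite (bigD1 (Ordinal jn))//= subrr mul0r expR0 subrr !mul0r.
- move=> s c s0 hc; have [_ mvs] := mv s.
  rewrite -(cvg_lim _ (cvg_norm mvs))//.
  apply: limr_ge; first exact: (cvgP _ (cvg_norm mvs)).
  near=> n; rewrite mU normrM normr_prod expRD mulrA mulrC.
  apply: ler_pM; rewrite ?expR_ge0 ?hc//.
    by rewrite mulr_ge0 ?expR_ge0//; lra.
  by apply: le_trans (ler_norm _); exact: moment_window_ge.
Unshelve. all: by end_near. Qed.

End AnnihilatingFunction.

(** * From a biorthogonal family to a solution of the moment problem *)

(** The series of the v_k, weighted by x_k over the diagonal moment, converges absolutely with a
    uniform bound. By biorthogonality the k-th moment of a partial sum equals x_k once n > k. *)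
Lemma moment_synthesis (R : realType) (T V M : R) (v : nat -> R -> R)
    (lambda x : nat -> R) :
  (forall k, bounded_on T (v k) V) ->
  (forall k j, j != k -> moment (v k) (lambda j) = 0) ->
  (forall k, moment (v k) (lambda k) != 0) ->
  (forall n, \sum_(k < n) `|x k / moment (v k) (lambda k)| <= M) ->
  exists u, bounded_on T u (M * V) /\ forall k, moment u (lambda k) = x k.
Proof.
move=> bv v0 vn0 xM.
pose c k := x k / moment (v k) (lambda k).
pose U n t := \sum_(k < n) c k * v k t.
have V0 : 0 <= V by case: (bv 0%N) => _ _ /(_ 0); exact: le_trans.
have bU' n : bounded_on T (U n) (\sum_(k < n) `|c k| * V).
  split.
  - rewrite (_ : U n = \sum_(k < n) (fun t => c k * v k t)); last first.
      by apply/funext => t; rewrite fct_sumE.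
    apply: (big_ind (fun f : R -> R => measurable_fun [set: R] f)).
    + exact: measurable_cst.
    + by move=> f g mf mg; exact: measurable_funD.
    + by move=> k _; case: (bv k) => mv _ _; exact: measurable_funM.
  - move=> t ht; apply: big1 => k _.
    by case: (bv k) => _ /(_ t ht) -> _; rewrite mulr0.
  - move=> t; apply: le_trans (ler_norm_sum _ _ _) _; apply: ler_sum => k _.
    by rewrite normrM ler_wpM2l//; case: (bv k) => _ _; exact.
have bU n : bounded_on T (U n) (M * V).
  apply: bounded_on_le (bU' n) => //.
  by rewrite -mulr_suml ler_wpM2r//; exact: xM.
have mU n s : moment (U n) s = \sum_(k < n) c k * moment (v k) s.
  elim: n => [|n IH].
    rewrite big_ord0 /moment /U.
    under eq_Rintegral do rewrite big_ord0 mulr0.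
    by rewrite Rintegral_cst// mul0r.
  rewrite big_ord_recr /= -IH -[X in _ = _ + X]opprK -mulNr -(momentZ _ _ (bv n)).
  rewrite -(momentB _ (bU n) (bounded_onZ (- c n) (bv n))).
  by congr (moment _ s); apply/funext => t; rewrite /U big_ord_recr /= mulNr opprK.
have cU t : cvgn (fun n => U n t).
  apply: (@bounded_increments_cvg _ _ (M * V)) => n.
  apply: le_trans (ler_wpM2r V0 (xM n)).
  rewrite mulr_suml; apply: ler_sum => k _.
  rewrite {1}/U big_ord_recr /= -/(U k t) [X in `|X|]addrC addKr normrM ler_wpM2l//.
  by case: (bv k) => _ _; exact.
have mu s := moment_cvg s bU (cU : forall t, U n t @[n --> \oo] --> limn (fun n => U n t)).
exists (fun t => limn (fun n => U n t)); split; first by case: (mu 0).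
move=> k; have [_ muk] := mu (lambda k).
rewrite -(cvg_lim _ muk)//; apply: lim_near_cst => //.
near=> n; rewrite mU.
have kn : (k < n)%N by near: n; exists k.+1.
rewrite (bigD1 (Ordinal kn))//= big1 ?addr0 ?divfK// => j jk.
by rewrite v0 ?mulr0// eq_sym.
Unshelve. all: by end_near. Qed.

(** * Sup bounds, L2 norms and l2 norms *)

Section Norms.
Context (R : realType).

Lemma moment_integral (T M s : R) (u : R -> R) : bounded_on T u M ->
  (moment u s)%:E =
  (\int[lebesgue_measure]_(t in `]0%R, T[) (expR (t * s) * u t)%:E)%E.
Proof.
move=> bu; rewrite /moment /Rintegral fineK; last first.
  by apply: integrable_fin_num => //; exact: integrable_moment bu.
rewrite [RHS]integral_mkcond; apply: eq_integral => t _; rewrite patchE.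
case: ifPn => // ht; case: bu => _ u0 _; rewrite u0 ?mulr0//.
by move: ht; rewrite notin_setE /= in_itv /= => /negP.
Qed.

Lemma L2_norm_bounded_on (T M : R) (u : R -> R) : 0 < T -> T <= 1 ->
  bounded_on T u M -> in_L2 T u /\ (L2_norm T u <= M%:E)%E.
Proof.
move=> T0 T1 [mu u0 uM].
have M0 : 0 <= M by exact: le_trans (uM 0).
have le : (L2_norm T u <= M%:E)%E.
  rewrite /L2_norm unlock.
  have -> : M%:E = ((M ^+ 2)%:E `^ 2^-1)%E.
    by rewrite poweR_EFin powR12_sqrt ?sqr_ge0// sqrtr_sqr ger0_norm.
  apply: gt0_ler_poweR => //.
  - by rewrite in_itv /= leey andbT; apply: integral_ge0 => t _; rewrite lee_fin powR_ge0.
  - by rewrite in_itv /= leey andbT lee_fin sqr_ge0.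
  - apply: (@le_trans _ _ (\int[lebesgue_0T T]_t (M ^+ 2)%:E)%E).
      apply: ge0_le_integral => //.
      + by move=> t _; exact: poweR_ge0.
      + apply: (@measurableT_comp _ _ _ _ _ _ (fun x : \bar R => x `^ 2)%E) => //.
          exact: measurable_poweR.
        by apply: measurableT_comp => //; exact/measurable_EFinP.
      + move=> t _; rewrite abse_EFin poweR_EFin lee_fin powR_mulrn//.
        by rewrite ler_sqr ?nnegrE.
    rewrite integral_cst//= /mrestr setTI.
    rewrite [X in (_ * X)%E]lebesgue_measure_itv /= lte_fin T0 sube0 -EFinM lee_fin.
    by rewrite ler_piMr ?sqr_ge0.
split => //; rewrite /in_L2 inE /=; apply/andP; split.
  by rewrite inE /=.
by rewrite inE /= /finite_norm; apply: le_lt_trans le _; rewrite ltry.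
Qed.

Lemma l2_norm_fin (y : nat -> R) : in_l2 y -> l2_norm y \is a fin_num.
Proof.
rewrite /in_l2 inE => /andP[_]; rewrite inE /= /finite_norm => h.
by rewrite ge0_fin_numE// Lnorm_ge0.
Qed.

Lemma normr_le_l2_norm (y : nat -> R) k : (`|y k|%:E <= l2_norm y)%E.
Proof.
rewrite /l2_norm Lnorm_counting//.
have -> : `|y k|%:E = ((`|y k|%:E `^ 2) `^ 2^-1)%E.
  by rewrite -poweRrM divff ?poweRe1// lee_fin.
have h0 i : (0 <= `|(EFin \o y) i| `^ 2)%E by exact: poweR_ge0.
apply: gt0_ler_poweR => //.
- by rewrite in_itv /= leey andbT lee_fin powR_ge0.
- by rewrite in_itv /= leey andbT; apply: nneseries_ge0.
- apply: le_trans (@nneseries_lim_ge _ _ xpredT 0%N k.+1 _); last by [].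
  by rewrite big_nat_recr//= leeDr// sume_ge0.
Qed.

End Norms.

(** * Elementary inequalities for exponentials, powers and the absorption of losses *)

Section Inequalities.
Context (R : realType).
Implicit Types x y s t : R.

(** From exp(y) >= y^3 / 6. The cube is chosen because y will be proportional to T mu_j^(1/4), which
    gives the summable mu_j^(-3/4) at the price T^(-3). *)
Lemma expRN_le_cube y : 0 < y -> expR (- y) <= 6 / y ^+ 3.
Proof.
move=> y0; have := expR_ge1Dxn 2 (ltW y0).
rewrite (_ : 3`!%:R = 6 :> R)// => h.
have y3 : 0 < y ^+ 3 by exact: exprn_gt0.
rewrite expRN -[6 / _]invf_div lef_pV2 ?posrE ?expR_gt0 ?divr_gt0//.
by lra.
Qed.

(** The right side is 1 / (1 + 1/(exp(y) - 1)), which is at least exp(-1/(exp(y) - 1)), and exp(y) -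
    1 >= y^3 / 6. *)
Lemma expR_cube_le y : 0 < y -> expR (- (6 / y ^+ 3)) <= 1 - expR (- y).
Proof.
move=> y0; have y3 : 0 < y ^+ 3 by exact: exprn_gt0.
have h : y ^+ 3 / 6 <= expR y - 1.
  by have := expR_ge1Dxn 2 (ltW y0); rewrite (_ : 3`!%:R = 6 :> R)//; lra.
have e1 : 0 < expR y - 1 by apply: lt_le_trans h; rewrite divr_gt0.
have ey := expR_gt0 y.
apply: (@le_trans _ _ (expR (- (expR y - 1)^-1))).
  by rewrite ler_expR lerN2 -[6 / _]invf_div lef_pV2 ?posrE ?divr_gt0.
rewrite [leLHS]expRN -[leRHS]invrK lef_pV2 ?posrE ?expR_gt0 ?invr_gt0//; last first.
  by rewrite subr_gt0 expR_lt1 oppr_lt0.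
apply: le_trans (expR_ge1Dx _); rewrite expRN le_eqVlt; apply/orP; left.
by apply/eqP; field; apply/andP; split; apply: lt0r_neq0.
Qed.

Lemma inv1DV_le y : 0 < y -> (1 + y^-1)^-1 <= 1 - expR (- y).
Proof.
move=> y0; have h := expR_ge1Dx y.
have : expR (- y) <= (1 + y)^-1.
  by rewrite expRN lef_pV2 ?posrE ?expR_gt0// addr_gt0.
suff -> : (1 + y^-1)^-1 = 1 - (1 + y)^-1 by lra.
by field; apply/andP; split; apply: lt0r_neq0; lra.
Qed.

(** For t >= 0 the difference of the two sides is (exp(t) - 1)^2 / exp(t); for t < 0 they agree.
    Nodes on either side of mu_k can then be treated alike. *)
Lemma normr_1BexpR_ge t : 1 - expR (- `|t|) <= `|1 - expR t|.
Proof.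
have [t0|t0] := leP 0 t; last first.
  by rewrite (ltr0_norm t0) opprK ler_norm.
rewrite (ger0_norm t0) distrC; apply: le_trans (ler_norm _).
rewrite expRN; have e1 : 1 <= expR t by apply: le_trans (expR_ge1Dx t); rewrite lerDl.
rewrite -subr_ge0.
have -> : expR t - 1 - (1 - (expR t)^-1) = (expR t - 1) ^+ 2 / expR t.
  by field; rewrite lt0r_neq0 ?expR_gt0.
by rewrite divr_ge0 ?sqr_ge0 ?expR_ge0.
Qed.

(** The exponent 1/12 is small enough for s = 5/8 + 1/12 = 17/24 and q = 1/12 to satisfy q + s <= 3
    (1 - s), as [absorb] will require. *)
Lemma ln_le_powR x : 0 < x -> ln x <= 12 * x `^ 12^-1.
Proof.
move=> x0; have h := ltW (ln_sublinear (powR_gt0 12^-1 x0)).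
by rewrite ln_powR in h; lra.
Qed.

(** Telescoping form of the integral comparison: the first m+1 terms sum to at most 6 - 5
    (m+1)^(-1/5). Passing to fifth roots makes the induction step polynomial. *)
Lemma sum_riemann_le n : \sum_(j < n) j.+1%:R `^ (- (6 / 5)) <= 6 :> R.
Proof.
pose r (m : nat) : R := m.+1%:R `^ 5^-1.
have r5 m : r m ^+ 5 = m.+1%:R.
  by rewrite -powR_mulrn ?powR_ge0// -powRrM mulVf// powRr1.
have r0 m : 0 < r m by apply: powR_gt0.
have rE (m : nat) : m.+1%:R `^ (- (6 / 5)) = (r m)^-1 ^+ 6.
  by rewrite exprVn -powR_invn ?powR_ge0// -powRrM; congr (_ `^ _); field.
suff key m : \sum_(j < m.+1) j.+1%:R `^ (- (6 / 5)) <= 6 - 5 / r m.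
  case: n => [|n]; first by rewrite big_ord0.
  by apply: le_trans (key n) _; rewrite gerBl divr_ge0// ltW.
elim: m => [|m IH].
  by rewrite big_ord1 /r !powR1 divr1; lra.
rewrite big_ord_recr /=; apply: le_trans (lerD IH (lexx _)) _.
rewrite rE; have [x0 y0] := (r0 m, r0 m.+1).
have : r m.+1 ^+ 5 = r m ^+ 5 + 1 by rewrite !r5 natr1.
set x := r m in x0 *; set y := r m.+1 in y0 * => yx.
have xy : x <= y.
  by rewrite -(@ler_pXn2r _ 5) ?nnegrE ?(ltW x0) ?(ltW y0)// yx lerDl.
(* Factor 1 = y^5 - x^5; each of the five monomials of the cofactor is at most y^4. *)
have d : 1 <= (y - x) * (5 * y ^+ 4).
  pose g := y ^+ 4 + y ^+ 3 * x + y ^+ 2 * x ^+ 2 + y * x ^+ 3 + x ^+ 4.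
  rewrite [leLHS](_ : _ = (y - x) * g); last first.
    by transitivity (y ^+ 5 - x ^+ 5); [rewrite yx addrC addKr | rewrite /g; ring].
  apply: ler_wpM2l; first by rewrite subr_ge0.
  have le i j : (i + j = 4)%N -> y ^+ i * x ^+ j <= y ^+ 4.
    move=> <-; rewrite exprD.
    by rewrite ler_wpM2l ?exprn_ge0 ?(ltW y0)// lerXn2r// nnegrE ltW.
  have := le 3 1 erefl; have := le 2 2 erefl.
  have := le 1 3 erefl; have := le 0 4 erefl.
  by rewrite /g !expr0 !expr1; lra.
suff : y^-1 ^+ 6 <= 5 / x - 5 / y by lra.
have -> : 5 / x - 5 / y = ((y - x) * (5 * y ^+ 4)) / (x * y ^+ 5).
  by field; rewrite !lt0r_neq0.
have -> : y^-1 ^+ 6 = 1 / (y * y ^+ 5) by field; rewrite lt0r_neq0.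
have p1 : 0 < y * y ^+ 5 by rewrite mulr_gt0 ?exprn_gt0.
have p2 : 0 < x * y ^+ 5 by rewrite mulr_gt0 ?exprn_gt0.
apply: ler_pM => //; first by rewrite invr_ge0 ltW.
by rewrite lef_pV2 ?posrE// ler_wpM2r ?exprn_ge0 ?(ltW y0).
Qed.

(** Write (x+2)^s = (x+2)(x+2)^(s-1) and use that u^(s-1) is nonincreasing. The main term of the
    counting function thus grows by O(1) over an interval of length 2. *)
Lemma powRD2_le x s : 1 <= x -> 0 <= s <= 1 -> (x + 2) `^ s <= x `^ s + 2.
Proof.
move=> x1 /andP[s0 s1].
have [-> |sn0] := eqVneq s 0; first by rewrite !powRr0; lra.
have sp : 0 < s by rewrite lt_neqAle eq_sym sn0.
have le u : 0 < u -> u <= x + 2 -> (x + 2) `^ (s - 1) <= u `^ (s - 1).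
  move=> u0 ux; rewrite -opprB !powRN lef_pV2 ?posrE ?powR_gt0//; last by lra.
  by apply: ge0_ler_powR; rewrite ?nnegrE; lra.
rewrite -(@mulr_powRB1 _ (x + 2) s _ sp); last by lra.
rewrite -(@mulr_powRB1 _ x s _ sp); last by lra.
rewrite mulrDl; apply: lerD; first by apply: ler_wpM2l; [lra|apply: le; lra].
apply: le_trans (_ : 2 * 1 <= _); last by rewrite mulr1.
apply: ler_wpM2l => //; apply: le_trans (le 1 _ _) _; rewrite ?powR1; lra.
Qed.

(** Either the linear term already dominates, or x^(1-s) <= B / D, which bounds x^s by the stated
    power. *)
Lemma absorb_linear (s D B x : R) : 0 < s < 1 -> 0 < D -> 0 < B -> 0 < x ->
  B * x `^ s <= D * x + B * (B / D) `^ (s / (1 - s)).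
Proof.
move=> /andP[s0 s1] D0 B0 x0.
have [h|h] := leP (B * x `^ s) (D * x).
  by apply: le_trans h _; rewrite lerDl mulr_ge0 ?powR_ge0// ltW.
apply: ler_wpDl; first by rewrite mulr_ge0 ?(ltW D0) ?(ltW x0).
rewrite (ler_wpM2l (ltW B0))//.
have h1 : x `^ (1 - s) <= B / D.
  rewrite powRB; last by rewrite lt0r_neq0// implybT.
  rewrite (powRr1 (ltW x0)) ler_pdivlMr// mulrAC ler_pdivrMr ?powR_gt0//.
  by rewrite mulrC ltW.
have -> : x `^ s = (x `^ (1 - s)) `^ (s / (1 - s)).
  by rewrite -powRrM; congr (_ `^ _); field; rewrite lt0r_neq0// subr_gt0.
apply: ge0_ler_powR => //; rewrite ?nnegrE ?powR_ge0//.
  by rewrite divr_ge0 ?subr_ge0 ?ltW.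
by rewrite divr_ge0 ?ltW.
Qed.

Lemma ler_powRV (T p q : R) : 0 < T < 1 -> p <= q -> (T `^ p)^-1 <= (T `^ q)^-1.
Proof.
move=> /andP[T0 T1] pq; rewrite lef_pV2 ?posrE ?powR_gt0//.
by apply: ger_powR => //; rewrite T0 ltW.
Qed.

(** With slope T/16 and coefficient B / T^q the remainder of [absorb_linear] is of order
    T^(-(q+s)/(1-s)); the hypothesis says that this exponent is at most p. *)
Lemma absorb (s q p B : R) : 0 < s < 1 -> 0 <= q -> 0 < B -> q + s <= p * (1 - s) ->
  exists2 G, 0 <= G & forall T x, 0 < T < 1 -> 0 < x ->
    B * x `^ s / T `^ q <= T / 16 * x + G / T `^ p.
Proof.
move=> s01 q0 B0 qsp; have /andP[s0 s1] := s01.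
have s1' : 0 < 1 - s by rewrite subr_gt0.
pose e := s / (1 - s).
exists (B * (16 * B) `^ e); first by rewrite mulr_ge0 ?powR_ge0 ?ltW.
move=> T x T01 x0; have /andP[T0 T1] := T01.
have Tq : 0 < T `^ q by exact: powR_gt0.
have := @absorb_linear s (T / 16) (B / T `^ q) x s01.
move=> /(_ _ _ x0); rewrite !divr_gt0// => /(_ isT isT); rewrite mulrAC.
move=> /le_trans; apply; rewrite lerD2l -/e.
have -> : B / T `^ q / (T / 16) = (16 * B) / T `^ (q + 1).
  rewrite powRD ?powRr1 ?(ltW T0)//; last by rewrite lt0r_neq0 ?implybT.
  by field; rewrite !lt0r_neq0.
rewrite powRM ?invr_ge0 ?powR_ge0 ?(mulr_ge0 _ (ltW B0))//.
rewrite (_ : (T `^ (q + 1))^-1 `^ e = (T `^ ((q + 1) * e))^-1); last first.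
  by rewrite -powRN -powR_inv1 ?powR_ge0// -!powRrM; congr (_ `^ _); ring.
rewrite -!mulrA; apply: ler_wpM2l; first exact: ltW.
rewrite [leLHS]mulrCA; apply: ler_wpM2l; first exact: powR_ge0.
rewrite -invfM -powRD; last by rewrite lt0r_neq0 ?implybT.
apply: ler_powRV => //.
rewrite /e -(ler_pM2r s1') mulrDl -mulrA divfK ?lt0r_neq0//; lra.
Qed.

End Inequalities.

(** * Distribution of the mu_j and lower bound for the product over the nodes *)

Lemma sum_ltn_ord (R : realType) (n q : nat) :
  \sum_(j < n) (j < q)%N%:R = (minn n q)%:R :> R.
Proof.
elim: n => [|n IH]; first by rewrite big_ord0 min0n.
by rewrite big_ord_recr /= IH -natrD; congr _%:R; case: ltnP => ?; lia.
Qed.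

Lemma sum_interval_ord_le (R : realType) (n p q : nat) : (p <= q)%N ->
  \sum_(j < n) (j < q)%N%:R - \sum_(j < n) (j < p)%N%:R <= (q - p)%:R :> R.
Proof. by move=> pq; rewrite !sum_ltn_ord -natrB ?ler_nat; lia. Qed.

Section Spectrum.
Context (R : realType) (a b cW1 cW2 cw : R).
Context (ha : 2^-1 <= a < 5 / 8) (hb : 0 < b < 2^-1).
Context (hcW1 : 0 < cW1) (hcW2 : 0 < cW2) (hcw : 0 < cw).
Context (mu : nat -> R) (hmu : increasing_seq mu) (hmu1 : 1 <= mu 0%N).
Context (hcount : forall Gamma : R, mu 0%N <= Gamma ->
      ((cW1 * Gamma `^ a - cW2 * Gamma `^ b)%:E
         <= counting_function mu Gamma)%E /\
      (counting_function mu Gamma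
         <= (cW1 * Gamma `^ a + cW2 * Gamma `^ b)%:E)%E).
Context (hgap : forall k : nat,
      expR (- cw * mu k `^ 2^-1) <= mu k.+1 - mu k).

Lemma spectrum_ge1 k : 1 <= mu k.
Proof. by apply: le_trans hmu1 _; rewrite hmu. Qed.

(** The finite upper bound excludes an infinite count, and monotonicity turns the counted set into
    the first m indices. *)
Lemma counting_initial_segment Gamma : mu 0%N <= Gamma ->
  exists m : nat, (forall j, (mu j <= Gamma) = (j < m)%N) /\
    cW1 * Gamma `^ a - cW2 * Gamma `^ b <= m%:R
      <= cW1 * Gamma `^ a + cW2 * Gamma `^ b.
Proof.
move=> /hcount[]; rewrite /counting_function /counting.
set S := [set k | mu k <= Gamma].
case: asboolP => [finS|_ _]; last by rewrite leye_eq.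
have exm : exists m, Gamma < mu m.
  apply: contrapT => /forallNP h; apply: infinite_nat.
  by apply: sub_finite_set finS => k _; rewrite /S /= leNgt; exact/negP.
case: (ex_minnP exm) => m mG min.
have mP j : (mu j <= Gamma) = (j < m)%N.
  have [jm|mj] := ltnP j m.
    by rewrite leNgt; apply: contraL jm => /min; rewrite -leqNgt.
  by apply/negbTE; rewrite -ltNge (lt_le_trans mG)// hmu.
have -> : size (finmap.enum_fset (fset_set S)) = m.
  have -> : S = `I_m by apply/seteqP; split => j; rewrite /S /= mP.
  exact: card_fset_set.
by rewrite !lee_fin => h1 h2; exists m; rewrite h1 h2.
Qed.

Lemma counting_upper Gamma m : 1 <= Gamma ->
  m%:R <= cW1 * Gamma `^ a + cW2 * Gamma `^ b ->
  m%:R <= (cW1 + cW2) * Gamma `^ (5 / 8).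
Proof.
have /andP[_ a58] := ha; have /andP[_ b12] := hb.
move=> G1 /le_trans; apply; rewrite mulrDl.
by apply: lerD; apply: ler_wpM2l; rewrite ?(ltW hcW1) ?(ltW hcW2)// ler_powR//; lra.
Qed.

(** Counting at mu_j gives j+1 <= c mu_j^(5/8); raising this to the power 6/5 compares mu_j^(-3/4)
    with (j+1)^(-6/5). *)
Lemma sum_spectrum_le : exists2 S, 0 < S &
  forall n, \sum_(j < n) mu j `^ (- (3 / 4)) <= S.
Proof.
pose c := cW1 + cW2; have c0 : 0 < c by exact: addr_gt0.
exists (c `^ (6 / 5) * 6); first by rewrite mulr_gt0 ?powR_gt0.
move=> n; apply: le_trans (ler_wpM2l (powR_ge0 _ _) (sum_riemann_le R n)).
rewrite mulr_sumr; apply: ler_sum => j _.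
have m1 := spectrum_ge1 j; have m0 : 0 < mu j by lra.
have [|m [mP /andP[_ mu_m]]] := @counting_initial_segment (mu j).
  by rewrite hmu.
have jm : (j < m)%N by rewrite -mP.
have jc : j.+1%:R <= c * mu j `^ (5 / 8).
  by apply: le_trans (counting_upper m1 mu_m); rewrite ler_nat.
rewrite !powRN ler_pdivlMr ?powR_gt0// mulrC ler_pdivrMr ?powR_gt0//.
rewrite (_ : mu j `^ (3 / 4) = (mu j `^ (5 / 8)) `^ (6 / 5)); last first.
  by rewrite -powRrM; congr (_ `^ _); field.
rewrite -powRM ?powR_ge0 ?(ltW c0)//.
by apply: ge0_ler_powR; rewrite ?nnegrE ?mulr_ge0 ?powR_ge0 ?(ltW c0).
Qed.

(** A distance is at least the consecutive gap above the smaller of the two nodes, and for j < k the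
    gap bound at mu_j is the better one. *)
Lemma spectrum_gap k j : j != k ->
  expR (- (cw * mu k `^ 2^-1)) <= `|mu k - mu j|.
Proof.
rewrite -mulNr neq_ltn => /orP[jk|kj].
- apply: le_trans (ler_norm _).
  apply: (@le_trans _ _ (mu j.+1 - mu j)); last by rewrite lerD2r hmu.
  apply: le_trans (hgap j); rewrite ler_expR !mulNr lerN2 (ler_wpM2l (ltW hcw))//.
  have m1 := spectrum_ge1 j.
  by apply: ge0_ler_powR; rewrite ?nnegrE ?hmu ?(ltnW jk)//; have := spectrum_ge1 k; lra.
- rewrite distrC; apply: le_trans (ler_norm _); apply: le_trans (hgap k) _.
  by rewrite lerD2r hmu.
Qed.

(** The indices p and q count the nodes up to mu_k - 1 and mu_k + 1. The main terms of these counts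
    differ by O(1), so only the remainder of order mu_k^b survives. *)
Lemma cluster_size : exists2 D, 0 < D & forall k, exists p q : nat,
  [/\ (p <= q)%N, forall j, ~~ (p <= j < q)%N -> 1 <= `|mu k - mu j|
    & (q - p)%:R <= D * mu k `^ b].
Proof.
pose c := cW1 + cW2; have c0 : 0 < c by exact: addr_gt0.
have c2 : 0 < c * (mu 0%N + 2) by rewrite mulr_gt0//; have := hmu1; lra.
exists (2 * cW1 + 3 * cW2 + c * (mu 0%N + 2)).
  by rewrite addr_gt0// addr_gt0// mulr_gt0.
have /andP[a12 a58] := ha; have /andP[b0 b12] := hb.
move=> k; have m1 := spectrum_ge1 k; have mub : 1 <= mu k `^ b.
  by rewrite -[leLHS](powRr0 (mu k)) ler_powR//; lra.
have [|q [qP /andP[_ hq]]] := @counting_initial_segment (mu k + 1).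
  by apply: le_trans (_ : mu k <= _); rewrite ?hmu// lerDl.
have qlarge j : ~~ (j < q)%N -> 1 <= `|mu k - mu j|.
  by rewrite -qP -ltNge distrC => h; apply: le_trans (ler_norm _); lra.
have [hk|hk] := leP (mu 0%N) (mu k - 1).
  have [p [pP /andP[hp _]]] := @counting_initial_segment (mu k - 1) hk.
  have pq : (p <= q)%N.
    rewrite leqNgt; apply/negP => qp; move: (qP q); rewrite ltnn => /negbT.
    by move: (pP q); rewrite qp => h; rewrite -ltNge => ?; have := hmu1; lra.
  exists p, q; split => // [j|].
    rewrite negb_and => /orP[|/qlarge//]; rewrite -ltnNge -pP => h.
    by apply: le_trans (ler_norm _); lra.
  rewrite natrB//.
  have ea : (mu k + 1) `^ a <= (mu k - 1) `^ a + 2.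
    rewrite (_ : mu k + 1 = (mu k - 1) + 2); last by ring.
    by apply: powRD2_le; have := hmu1; lra.
  have eb1 : (mu k + 1) `^ b <= 2 * mu k `^ b.
    apply: (@le_trans _ _ ((2 * mu k) `^ b)).
      by apply: ge0_ler_powR; rewrite ?nnegrE; lra.
    rewrite powRM//; last by lra.
    rewrite ler_wpM2r ?powR_ge0//.
    by rewrite -[leRHS](@powRr1 _ 2)// ler_powR//; lra.
  have eb2 : (mu k - 1) `^ b <= mu k `^ b.
    by apply: ge0_ler_powR; rewrite ?nnegrE; have := hmu1; lra.
  have e1 : cW1 * (mu k + 1) `^ a <= cW1 * ((mu k - 1) `^ a + 2).
    by rewrite ler_wpM2l ?(ltW hcW1).
  have e2 : cW2 * (mu k + 1) `^ b <= cW2 * (2 * mu k `^ b).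
    by rewrite ler_wpM2l ?(ltW hcW2).
  have e3 : cW2 * (mu k - 1) `^ b <= cW2 * mu k `^ b.
    by rewrite ler_wpM2l ?(ltW hcW2).
  have e4 : cW1 * 2 <= cW1 * 2 * mu k `^ b.
    by rewrite ler_peMr// mulr_ge0 ?(ltW hcW1).
  have e5 : 0 <= c * (mu 0%N + 2) * mu k `^ b.
    by rewrite mulr_ge0 ?powR_ge0 ?(ltW c2).
  rewrite [leRHS]mulrDl; lra.
(* Here mu_k - 1 lies below mu_1, where the counting hypothesis gives nothing; but mu_k + 1 < mu_1 +
   2, so the whole count up to mu_k + 1 is bounded. *)
exists 0%N, q; split => //.
rewrite subn0; apply: (@le_trans _ _ (c * (mu 0%N + 2))).
  apply: le_trans (counting_upper _ hq) _; first by lra.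
  rewrite (ler_wpM2l (ltW c0))//.
  apply: (@le_trans _ _ (mu k + 1)); last by lra.
  by apply: ler1_powR; lra.
apply: (@le_trans _ _ (c * (mu 0%N + 2) * mu k `^ b)); first by rewrite ler_peMr// ltW.
by rewrite ler_wpM2r ?powR_ge0// lerDr addr_ge0// mulr_ge0// ltW.
Qed.

(** Since 1/y <= exp(L) / t, one has 1 + 1/y <= (1 + 1/t) exp(L): the cost splits into a logarithm
    and the cost L of a small distance. *)
Lemma near_factor_ge (t d L y : R) : 0 < t -> 0 <= L -> expR (- L) <= d ->
  t * d <= y -> expR (- (ln (1 + t^-1) + L)) <= 1 - expR (- y).
Proof.
move=> t0 L0 Ld tdy; have d0 : 0 < d by apply: lt_le_trans Ld; exact: expR_gt0.
have y0 : 0 < y by apply: lt_le_trans tdy; exact: mulr_gt0.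
have s0 : 0 < t^-1 by rewrite invr_gt0.
have eL1 : 1 <= expR L by rewrite -[leLHS]expR0 ler_expR.
apply: le_trans (inv1DV_le y0).
rewrite expRN expRD lnK ?posrE ?addr_gt0//.
have yi0 : 0 < y^-1 by rewrite invr_gt0.
rewrite lef_pV2 ?posrE ?mulr_gt0 ?expR_gt0 ?addr_gt0//.
have : y^-1 <= t^-1 * expR L.
  rewrite -[expR L]invrK -expRN -invfM lef_pV2 ?posrE ?mulr_gt0 ?expR_gt0//.
  by apply: le_trans tdy; rewrite ler_wpM2l ?(ltW t0).
by rewrite mulrDl mul1r; lra.
Qed.

(** The three terms are the costs of the far nodes, of the O(mu_k^(5/8)) nodes up to 2 mu_k (a
    logarithm each, bounded by a power 1/12), and of the O(mu_k^b) cluster nodes (an extra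
    mu_k^(1/2) each). *)
Lemma node_product_ge (kap : R) : 0 < kap <= 1 ->
  exists2 G, 0 < G & forall (T : R) (k n : nat), 0 < T < 1 ->
    expR (- (G / T ^+ 3 + G * mu k `^ (17 / 24) / T `^ 12^-1
             + G * mu k `^ (b + 2^-1))) <=
    \prod_(j < n | j != k :> nat)
      `|1 - expR ((mu k - mu j) * (kap * T * mu j `^ (- (3 / 4))))|.
Proof.
move=> /andP[kap0 kap1].
have [S S0 hS] := sum_spectrum_le.
have [D D0 hD] := cluster_size.
pose c := cW1 + cW2; have c0 : 0 < c by exact: addr_gt0.
(* 48 = 6 * 2^3 comes from [expR_cube_le] at half the far distance, 36 = 12 * 3 from [ln_le_powR]
   and 1 + 1/t <= (3 / kap)(mu_k / T). *)
pose G1 := 48 * S / kap ^+ 3; pose G2 := 2 * c * (36 / kap); pose G3 := D * cw.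
have G10 : 0 < G1 by rewrite /G1 divr_gt0 ?mulr_gt0 ?exprn_gt0.
have G20 : 0 < G2 by rewrite /G2 !mulr_gt0 ?invr_gt0.
have G30 : 0 < G3 by rewrite /G3 mulr_gt0.
exists (G1 + G2 + G3); first by rewrite !addr_gt0.
move=> T k n /andP[T0 T1].
have [p [q [pq far hqp]]] := hD k.
have m1 := spectrum_ge1 k; have m0 : 0 < mu k by lra.
have [|m [mP /andP[_ hm]]] := @counting_initial_segment (2 * mu k).
  by apply: (@le_trans _ _ (mu k)); rewrite ?hmu//; lra.
have kT0 : 0 < kap * T by exact: mulr_gt0.
(* For mu_j <= 2 mu_k this is a lower bound of the shift, because mu_j^(-3/4) >= 1/mu_j. *)
pose t := kap * T / (2 * mu k); have t0 : 0 < t by rewrite divr_gt0// mulr_gt0.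
pose A := ln (1 + t^-1); pose L := cw * mu k `^ 2^-1.
have A0 : 0 <= A by rewrite ln_ge0// lerDl invr_ge0 ltW.
have L0 : 0 <= L by rewrite mulr_ge0 ?powR_ge0 ?(ltW hcw).
pose K := 48 / (kap * T) ^+ 3.
have K0 : 0 <= K by rewrite divr_ge0// exprn_ge0// ltW.
(* The cost of node j: K for the far nodes, A for those with mu_j <= 2 mu_k, and
   the extra L for those in the cluster around mu_k. *)
pose ell (j : nat) : R := K * mu j `^ (- (3 / 4)) + (j < m)%N%:R * A +
   ((j < q)%N%:R - (j < p)%N%:R) * L.
have qp0 (j : nat) : 0 <= (j < q)%N%:R - (j < p)%N%:R :> R.
  by rewrite subr_ge0 ler_nat; case: (ltnP j p) => // jp; rewrite (leq_trans jp pq).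
have ell0 j : 0 <= ell j.
  by rewrite /ell !addr_ge0// mulr_ge0// powR_ge0.
have factor j : j != k ->
    expR (- ell j) <= `|1 - expR ((mu k - mu j) * (kap * T * mu j `^ (- (3 / 4))))|.
  move=> jk; have j1 := spectrum_ge1 j; have j0 : 0 < mu j by lra.
  set w := mu j `^ (- (3 / 4)); have w0 : 0 < w by exact: powR_gt0.
  apply: le_trans (normr_1BexpR_ge _).
  rewrite normrM [X in _ * X]ger0_norm; last by rewrite mulr_ge0 ?(ltW kT0) ?(ltW w0).
  set y := _ * (kap * T * w).
  (* For a far node the distance is at least mu_j / 2, so y >= kap T mu_j^(1/4) / 2 and the cube
     bound costs exactly K mu_j^(-3/4). *)
  have [jm|mj] := boolP (j < m)%N; last first.
    have far2 : 2 * mu k < mu j by rewrite ltNge mP.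
    have muw : mu j * w = mu j `^ 4^-1.
      rewrite -{1}(powRr1 (ltW j0)) /w -powRD; last by rewrite lt0r_neq0 ?implybT.
      by congr (_ `^ _); lra.
    have y1 : kap * T * mu j `^ 4^-1 / 2 <= y.
      rewrite -muw /y distrC ger0_norm; last by lra.
      have : kap * T * w * (mu j / 2) <= kap * T * w * (mu j - mu k).
        by rewrite ler_wpM2l ?mulr_ge0 ?(ltW kT0) ?(ltW w0)//; lra.
      by lra.
    have y0 : 0 < kap * T * mu j `^ 4^-1 / 2.
      by rewrite divr_gt0// mulr_gt0// powR_gt0.
    apply: (@le_trans _ _ (1 - expR (- (kap * T * mu j `^ 4^-1 / 2)))); last first.
      by rewrite lerD2l lerN2 ler_expR lerN2.
    apply: le_trans (expR_cube_le y0); rewrite ler_expR lerN2 /ell (negbTE mj) mul0r addr0.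
    apply: ler_wpDr; first exact: mulr_ge0.
    rewrite le_eqVlt; apply/orP; left; apply/eqP; rewrite /K.
    have -> : mu j `^ (- (3 / 4)) = ((mu j `^ 4^-1) ^+ 3)^-1.
      by rewrite powRN -powR_mulrn ?powR_ge0// -powRrM; congr (_ `^ _)^-1; lra.
    by field; rewrite !lt0r_neq0 ?powR_gt0.
  have tw : t <= kap * T * w.
    rewrite /t ler_wpM2l ?(ltW kT0)// /w powRN lef_pV2 ?posrE ?powR_gt0 ?mulr_gt0//.
    apply: (@le_trans _ _ (mu j)); last by rewrite mP.
    by apply: ler1_powR => //; lra.
  (* Used with d = exp(-L) inside the cluster, and with d = 1 and no extra cost outside it. *)
  have near (d Lj : R) : 0 <= Lj -> expR (- Lj) <= d -> d <= `|mu k - mu j| ->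
      Lj <= ((j < q)%N%:R - (j < p)%N%:R) * L -> expR (- ell j) <= 1 - expR (- y).
    move=> Lj0 Ljd dmu LjL.
    apply: le_trans (near_factor_ge t0 Lj0 Ljd _); last first.
      rewrite /y [leRHS]mulrC; apply: ler_pM => //; first exact: ltW.
      by apply: le_trans Ljd; exact: expR_ge0.
    rewrite ler_expR lerN2 /ell jm mul1r -/A.
    have : 0 <= K * mu j `^ (- (3 / 4)) by rewrite mulr_ge0 ?powR_ge0.
    lra.
  have [/andP[pj jq]|npq] := boolP (p <= j < q)%N.
    apply: (near _ L L0 (lexx _)); first by rewrite /L spectrum_gap.
    by rewrite jq ltnNge pj /= subr0 mul1r.
  apply: (near 1 0 (lexx _)); rewrite ?oppr0 ?expR0//; first exact: far.
  exact: mulr_ge0.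
apply: (@le_trans _ _ (\prod_(j < n | j != k :> nat) expR (- ell j))); last first.
  by apply: ler_prod => j jk; rewrite expR_ge0 factor.
rewrite -expR_sum ler_expR sumrN lerN2.
apply: (@le_trans _ _ (\sum_(j < n) ell j)).
  by rewrite [leRHS](bigID (fun j : 'I_n => j != k :> nat)) /= lerDl sumr_ge0.
rewrite /ell !big_split /= -mulr_sumr -!mulr_suml sumrB.
have b1 : K * \sum_(j < n) mu j `^ (- (3 / 4)) <= G1 / T ^+ 3.
  have -> : G1 / T ^+ 3 = K * S by rewrite /G1 /K; field; rewrite !lt0r_neq0.
  exact: ler_wpM2l.
have b2 : (\sum_(j < n) (j < m)%N%:R) * A <= G2 * mu k `^ (17 / 24) / T `^ 12^-1.
  rewrite sum_ltn_ord; have hm2 : (minn n m)%:R <= 2 * c * mu k `^ (5 / 8).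
    apply: (@le_trans _ _ m%:R); first by rewrite ler_nat geq_minr.
    apply: le_trans (counting_upper _ hm) _; first by lra.
    rewrite -/c powRM ?(ltW m0)// mulrCA -mulrA.
    rewrite ler_wpM2r ?mulr_ge0 ?powR_ge0 ?(ltW c0)//.
    by rewrite -[leRHS](@powRr1 _ 2)// ler_powR//; lra.
  have hA : A <= 36 / kap * (mu k `^ 12^-1 / T `^ 12^-1).
    have s0 : 0 < t^-1 by rewrite invr_gt0.
    apply: le_trans (ln_le_powR (addr_gt0 ltr01 s0)) _.
    have -> : 36 / kap = 12 * (3 / kap) by field; exact: lt0r_neq0.
    rewrite -mulrA ler_wpM2l//.
    apply: (@le_trans _ _ ((3 / kap * (mu k / T)) `^ 12^-1)).
      apply: ge0_ler_powR; rewrite ?nnegrE//.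
      - by rewrite addr_ge0// ltW.
      - by rewrite mulr_ge0 ?divr_ge0 ?(ltW kap0) ?(ltW m0) ?(ltW T0).
      have -> : 3 / kap * (mu k / T) = (kap * T)^-1 * mu k + t^-1.
        by rewrite /t; field; rewrite !lt0r_neq0.
      rewrite lerD2r mulrC ler_pdivlMr// mul1r.
      by apply: (@le_trans _ _ 1) => //; rewrite mulr_ile1 ?(ltW kap0) ?(ltW T0) ?(ltW T1).
    have k3 : 1 <= 3 / kap by rewrite ler_pdivlMr//; lra.
    rewrite powRM ?divr_ge0 ?(ltW kap0) ?(ltW m0) ?(ltW T0)//.
    apply: ler_pM; rewrite ?powR_ge0//; first by apply: ler1_powR => //; lra.
    rewrite powRM ?invr_ge0 ?(ltW m0) ?(ltW T0)// le_eqVlt; apply/orP; left.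
    by rewrite -(powR_inv1 (ltW T0)) -powRrM mulN1r powRN.
  apply: le_trans (ler_pM _ A0 hm2 hA) _; first exact: ler0n.
  rewrite le_eqVlt; apply/orP; left; apply/eqP.
  have -> : mu k `^ (17 / 24) = mu k `^ (5 / 8) * mu k `^ 12^-1.
    by rewrite -powRD; [congr (_ `^ _); lra | rewrite lt0r_neq0 ?implybT].
  by rewrite /G2; field; rewrite !lt0r_neq0 ?powR_gt0.
have b3 : (\sum_(j < n) (j < q)%N%:R - \sum_(j < n) (j < p)%N%:R) * L <= G3 * mu k `^ (b + 2^-1).
  have -> : G3 * mu k `^ (b + 2^-1) = D * mu k `^ b * L.
    rewrite powRD; last by rewrite lt0r_neq0 ?implybT.
    by rewrite /G3 /L; ring.
  by rewrite ler_wpM2r//; exact: le_trans (sum_interval_ord_le _ _ pq) hqp.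
have l1 : G1 <= G1 + G2 + G3 by lra.
have l2 : G2 <= G1 + G2 + G3 by lra.
have l3 : G3 <= G1 + G2 + G3 by lra.
apply: lerD; first apply: lerD.
- by apply: le_trans b1 _; rewrite ler_wpM2r// invr_ge0 exprn_ge0 ?(ltW T0).
- by apply: le_trans b2 _; rewrite !ler_wpM2r ?invr_ge0 ?powR_ge0.
- by apply: le_trans b3 _; rewrite ler_wpM2r ?powR_ge0.
Qed.

End Spectrum.

(** * The exponent alpha and the assembly of the control *)

(** These are the conditions under which [absorb] applies with p = alpha to the three losses. They
    follow from eps <= (1 - 2b)/4 < 1/4 and the two terms of the maximum. *)
Lemma alpha_lower_bounds (R : realType) (a b delta : R) :
  2^-1 <= a < 5 / 8 -> 0 < b < 2^-1 -> 0 < delta < 1 ->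
  let al := alpha (epsilon a b) delta in
  [/\ 3 <= al, 1 - delta <= al * delta & b + 2^-1 <= al * (2^-1 - b)].
Proof.
move=> /andP[a1 a2] /andP[b0 b1] /andP[d0 d1] al.
pose eps := epsilon a b.
have e0 : 0 < eps by rewrite /eps /epsilon mulr_gt0// lt_min; apply/andP; split; lra.
have e1 : eps <= 4^-1 * (1 - 2 * b) by rewrite ler_wpM2l// ge_min lexx orbT.
have h1 : (1 - eps) / eps <= al by rewrite /al /alpha le_max lexx.
have h2 : (1 - delta) / delta <= al by rewrite /al /alpha le_max lexx orbT.
move: h1 h2; rewrite !ler_pdivrMr// => h1 h2.
have al0 : 0 <= al by nra.
by split => //; nra.
Qed.

Lemma ge_of_weighted (R : realType) (z x u N : R) : expR (- u) <= `|z| ->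
  `|z * x| <= N -> `|x| <= N * expR u.
Proof.
move=> hz hN; rewrite -[expR u]invrK -expRN ler_pdivlMr ?expR_gt0//.
by apply: le_trans hN; rewrite normrM mulrC ler_wpM2r.
Qed.

Theorem theorem1p1 (R : realType) (a b cW1 cW2 cw : R)
    (ha : 2^-1 <= a < 5 / 8) (hb : 0 < b < 2^-1)
    (hcW1 : 0 < cW1) (hcW2 : 0 < cW2) (hcw : 0 < cw)
    (mu : nat -> R) (hmu : increasing_seq mu) (hmu1 : 1 <= mu 0%N)
    (hcount : forall Gamma : R, mu 0%N <= Gamma ->
      ((cW1 * Gamma `^ a - cW2 * Gamma `^ b)%:E
         <= counting_function mu Gamma)%E /\
      (counting_function mu Gamma
         <= (cW1 * Gamma `^ a + cW2 * Gamma `^ b)%:E)%E)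
    (hgap : forall k : nat,
      expR (- cw * mu k `^ 2^-1) <= mu k.+1 - mu k)
    (z : nat -> R) (hz : in_l2 z) (delta : R) (hdelta : 0 < delta < 1)
    (hzlow : exists2 Cz : R, 0 < Cz &
      forall k : nat, expR (- Cz * mu k `^ (1 - delta)) <= `|z k|) :
  exists2 C : R, 0 < C &
    forall (T : R) (x : nat -> R), 0 < T < 1 ->
      in_l2 (fun k => z k * x k) ->
      exists u : R -> R,
        [/\ in_L2 T u,
            forall k : nat,
              (x k)%:E = (\int[lebesgue_measure]_(t in `]0%R, T[)
                            (expR (t * mu k) * u t)%:E)%E
          & (L2_norm T u <=
               (C * expR (C / T `^ alpha (epsilon a b) delta))%:E
               * l2_norm (fun k => z k * x k)%R)%E].
Proof.
have [Cz Cz0 zlow] := hzlow; clear hzlow.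
have mu_ge1 k : 1 <= mu k by exact: (spectrum_ge1 hmu hmu1).
have mu_gt0 k : 0 < mu k by exact: lt_le_trans (mu_ge1 k).
have [S S0 hS] := sum_spectrum_le ha hb hcW1 hcW2 hmu hmu1 hcount.
(* Normalises the shifts so that they sum to at most T/2; the added 1 ensures kap <= 1. *)
pose kap : R := (2 * (S + 1))^-1.
have kap0 : 0 < kap by rewrite invr_gt0 mulr_gt0// addr_gt0.
have kap1 : kap <= 1 by rewrite invf_le1; lra.
have kapS : kap * S <= 2^-1.
  rewrite /kap mulrC ler_pdivrMr; lra.
have [G G0 hG] : exists2 G, 0 < G & forall (T : R) (k n : nat), 0 < T < 1 -> _ :=
  node_product_ge ha hb hcW1 hcW2 hcw hmu hmu1 hcount hgap (introT andP (conj kap0 kap1)).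
set al := alpha _ _.
have [al3 ald alb] : [/\ 3 <= al, 1 - delta <= al * delta
    & b + 2^-1 <= al * (2^-1 - b)] := alpha_lower_bounds ha hb hdelta.
have /andP[d0 d1] := hdelta; have /andP[b0 b1] := hb.
(* Three losses, from |z_k|, the low nodes and the cluster, each use T mu_k / 16 of the gain T mu_k
   / 4, so T mu_k / 16 remains. The factor T^0 stands for a loss without a power of T. *)
have [g1 g10 h1] : exists2 g, 0 <= g & forall T x : R, 0 < T < 1 -> 0 < x ->
    Cz * x `^ (1 - delta) / T `^ 0 <= T / 16 * x + g / T `^ al.
  apply: absorb => //; first by apply/andP; split; lra.
  by rewrite add0r subKr.
have [g2 g20 h2] : exists2 g, 0 <= g & forall T x : R, 0 < T < 1 -> 0 < x ->
    G * x `^ (17 / 24) / T `^ 12^-1 <= T / 16 * x + g / T `^ al.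
  by apply: absorb => //; lra.
have [g3 g30 h3] : exists2 g, 0 <= g & forall T x : R, 0 < T < 1 -> 0 < x ->
    G * x `^ (b + 2^-1) / T `^ 0 <= T / 16 * x + g / T `^ al.
  apply: absorb => //; first by apply/andP; split; lra.
  by rewrite add0r (_ : 1 - (b + 2^-1) = 2^-1 - b)//; lra.
pose g := G + g1 + g2 + g3; have g0 : 0 < g by rewrite /g; lra.
pose h := 6 * S / kap ^+ 3.
have h0 : 0 < h by rewrite /h divr_gt0 ?mulr_gt0 ?exprn_gt0.
(* 64 S is the prefactor from summing the coefficients. In the exponent, g collects the losses, 1
   pays for T^(-2), and h for the sup bound exp(B) of the v_k. *)
exists (64 * S + (g + 1 + h)); first by lra.
set C := 64 * S + _.
move=> T x T01 zx; have /andP[T0 T1] := T01.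
pose X := (T `^ al)^-1; have X0 : 0 < X by rewrite invr_gt0 powR_gt0.
have T3X : (T ^+ 3)^-1 <= X.
  by rewrite -powR_mulrn ?(ltW T0)//; exact: ler_powRV.
pose tau (j : nat) := kap * T * mu j `^ (- (3 / 4)).
have tau0 j : 0 <= tau j by rewrite !mulr_ge0 ?powR_ge0 ?(ltW kap0) ?(ltW T0).
have tauT n : \sum_(j < n) tau j <= T / 2.
  rewrite /tau -mulr_sumr; apply: le_trans (ler_wpM2l _ (hS n)) _.
    by rewrite mulr_ge0 ?(ltW kap0) ?(ltW T0).
  by rewrite mulrAC mulrC ler_wpM2l// ltW.
pose B := h / T ^+ 3.
(* Here mu_j tau_j = kap T mu_j^(1/4), so the cube bound again produces the convergent sum of the
   mu_j^(-3/4). *)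
have tauB n : \sum_(j < n) expR (- (mu j * tau j)) <= B.
  have -> : B = 6 / (kap * T) ^+ 3 * S by rewrite /B /h; field; rewrite !lt0r_neq0.
  apply: le_trans (ler_wpM2l _ (hS n)); last first.
    by rewrite divr_ge0// exprn_ge0// mulr_ge0 ?(ltW kap0) ?(ltW T0).
  rewrite mulr_sumr; apply: ler_sum => j _.
  have -> : mu j * tau j = kap * T * mu j `^ 4^-1.
    rewrite /tau mulrCA -{1}(powRr1 (ltW (mu_gt0 j))) -powRD.
      by congr (_ * _ `^ _); lra.
    by rewrite lt0r_neq0 ?implybT.
  apply: le_trans (expRN_le_cube _) _; first by rewrite !mulr_gt0 ?powR_gt0.
  rewrite le_eqVlt; apply/orP; left; apply/eqP.
  have -> : mu j `^ (- (3 / 4)) = ((mu j `^ 4^-1) ^+ 3)^-1.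
    by rewrite powRN -powR_mulrn ?powR_ge0// -powRrM; congr (_ `^ _)^-1; lra.
  by field; rewrite !lt0r_neq0 ?powR_gt0.
pose c k := G / T ^+ 3 + G * mu k `^ (17 / 24) / T `^ 12^-1 + G * mu k `^ (b + 2^-1).
have /choice[v hv] k : exists v : R -> R,
    [/\ bounded_on T v (expR B),
        forall j, j != k -> moment v (mu j) = 0
      & T / 4 * expR (T / 4 * mu k - c k) <= `|moment v (mu k)|].
  have [v [bv v0 vlow]] :=
    annihilating_function (fun j => j != k) T0 tau0 tauT tauB.
  exists v; split => //; apply: vlow => [|n]; first exact: ltW.
  exact: hG.
set N := fine (l2_norm (fun k => z k * x k)).
have NE : l2_norm (fun k => z k * x k) = N%:E by rewrite fineK// l2_norm_fin.
have xN k : `|x k| <= N * expR (Cz * mu k `^ (1 - delta)).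
  apply: (@ge_of_weighted _ (z k)); first by rewrite -mulNr.
  by rewrite -lee_fin -NE (normr_le_l2_norm (fun k => z k * x k)).
have N0 : 0 <= N.
  by rewrite -lee_fin -NE; apply: le_trans (normr_le_l2_norm _ 0%N); rewrite lee_fin.
have coeff k : `|x k / moment (v k) (mu k)| <=
    N * (64 / T ^+ 2) * expR (g * X) * mu k `^ (- (3 / 4)).
  have [_ _ low] := hv k; have k0 := mu_gt0 k.
  have low0 : 0 < T / 4 * expR (T / 4 * mu k - c k).
    by rewrite mulr_gt0 ?expR_gt0 ?divr_gt0.
  rewrite normrM normfV.
  apply: (@le_trans _ _ (N * expR (Cz * mu k `^ (1 - delta)) *
      (T / 4 * expR (T / 4 * mu k - c k))^-1)).
    apply: ler_pM => //.
    by rewrite lef_pV2 ?posrE// (lt_le_trans low0).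
  have -> : N * expR (Cz * mu k `^ (1 - delta)) *
      (T / 4 * expR (T / 4 * mu k - c k))^-1 =
      N * (4 / T) * expR (Cz * mu k `^ (1 - delta) + c k - T / 4 * mu k).
    rewrite (_ : _ + c k - _ = Cz * mu k `^ (1 - delta) - (T / 4 * mu k - c k)).
      move: (T / 4 * mu k - c k) => w; rewrite expRB; field.
      by rewrite !lt0r_neq0 ?expR_gt0.
    by ring.
  have e1 : Cz * mu k `^ (1 - delta) + c k - T / 4 * mu k <= g * X - T / 16 * mu k.
    have := h1 T (mu k) T01 k0; have := h2 T (mu k) T01 k0; have := h3 T (mu k) T01 k0.
    rewrite powRr0 !divr1 -/X /c /g.
    have : G / T ^+ 3 <= G * X by rewrite ler_wpM2l// ltW.
    by lra.
  (* The remaining gain makes the coefficients summable: exp(-y) <= 1/y and 1/mu_k <=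
     mu_k^(-3/4). *)
  have e2 : expR (- (T / 16 * mu k)) <= 16 / T * mu k `^ (- (3 / 4)).
    have y0 : 0 < T / 16 * mu k by rewrite mulr_gt0 ?divr_gt0.
    apply: (@le_trans _ _ (T / 16 * mu k)^-1).
      rewrite expRN lef_pV2 ?posrE ?expR_gt0//.
      by apply: le_trans (expR_ge1Dx _); rewrite lerDr.
    rewrite invfM invf_div ler_wpM2l ?divr_ge0 ?(ltW T0)// powRN.
    by rewrite lef_pV2 ?posrE ?powR_gt0// ler1_powR//; lra.
  apply: (@le_trans _ _ (N * (4 / T) * (expR (g * X) * (16 / T * mu k `^ (- (3 / 4)))))).
    rewrite ler_wpM2l ?mulr_ge0 ?invr_ge0 ?(ltW T0)//.
    apply: (@le_trans _ _ (expR (g * X - T / 16 * mu k))); first by rewrite ler_expR.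
    by rewrite expRD ler_wpM2l ?expR_ge0.
  by rewrite le_eqVlt; apply/orP; left; apply/eqP; field; exact: lt0r_neq0.
pose M := N * (64 / T ^+ 2) * expR (g * X) * S.
have sumM n : \sum_(k < n) `|x k / moment (v k) (mu k)| <= M.
  apply: le_trans (ler_sum _ (fun (k : 'I_n) _ => coeff k)) _.
  rewrite -mulr_sumr; apply: ler_wpM2l; last exact: hS.
  by rewrite mulr_ge0 ?expR_ge0// mulr_ge0// divr_ge0// exprn_ge0 ?(ltW T0).
have vne k : moment (v k) (mu k) != 0.
  have [_ _ low] := hv k; rewrite -normr_gt0; apply: lt_le_trans low.
  by rewrite mulr_gt0 ?expR_gt0 ?divr_gt0.
have [u [bu ux]] := moment_synthesis (fun k => let: And3 bv _ _ := hv k in bv)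
  (fun k => let: And3 _ v0 _ := hv k in v0) vne sumM.
have [uL2 uN] := L2_norm_bounded_on T0 (ltW T1) bu.
exists u; split => // [k|]; first by rewrite -ux (moment_integral _ bu).
apply: le_trans uN _; rewrite NE -EFinM lee_fin.
have T2X : (T ^+ 2)^-1 <= expR X.
  apply: (@le_trans _ _ X); last by apply: le_trans (expR_ge1Dx X); rewrite lerDr.
  apply: le_trans T3X; rewrite lef_pV2 ?posrE ?exprn_gt0//.
  by rewrite exprSr ler_piMr ?exprn_ge0 ?(ltW T0) ?(ltW T1).
have BX : expR B <= expR (h * X) by rewrite ler_expR ler_wpM2l ?(ltW h0).
have -> : M * expR B = 64 * S * N * expR (g * X) * ((T ^+ 2)^-1 * expR B).
  by rewrite /M; ring.
apply: (@le_trans _ _ (64 * S * N * expR (g * X) * (expR X * expR (h * X)))).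
  rewrite ler_wpM2l//; first by rewrite !mulr_ge0 ?expR_ge0 ?(ltW S0).
  by apply: ler_pM; rewrite ?expR_ge0// invr_ge0 exprn_ge0 ?(ltW T0).
rewrite -/X -[X in _ * _ * X]expRD -mulrA -expRD.
have -> : g * X + (X + h * X) = (g + 1 + h) * X by ring.
have eC : expR ((g + 1 + h) * X) <= expR (C * X).
  by rewrite ler_expR ler_wpM2r ?(ltW X0)// /C lerDr mulr_ge0 ?(ltW S0).
have sC : 64 * S <= C by rewrite /C; lra.
rewrite mulrAC; apply: ler_wpM2r => //.
by apply: ler_pM; rewrite ?expR_ge0 ?mulr_ge0 ?(ltW S0).
Qed.
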